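(* Let $A$ be an introenumerable set whose complement is c.e. Then $A$ is majorreducible.
   Context: An enumeration operator $\Theta$ is a c.e. set of pairs $\langle u,n\rangle$, with $\Theta(X)=\{n:\exists u\,(D_u\subseteq X\wedge\langle u,n\rangle\in\Theta)\}$; $A\le_e X$ if $A=\Theta(X)$ for some enumeration operator $\Theta$. An infinite set $A$ is introenumerable if $A\le_e C$ for every infinite $C\subseteq A$. $A$ is majorreducible if every function $f$ with $f(n)\ge p_A(n)$ for all $n$ computes $A$, where $p_A$ is the principal function of $A$ ($p_A(n)$ is the $n$-th element of $A$ in increasing order). *)

(* Defs.v *)
From mathcomp Require Import all_boot.
From mathcomp Require Import boolp classical_sets functions cardinality.

Set Implicit Arguments.
Unset Strict Implicit.
Unset Printing Implicit Defensive.

Local Open Scope classical_set_scope.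

(* Kleene's schemes for partial recursive functions of k arguments relative
   to a family of oracles indexed by O. *)
Inductive rfun (O : Type) : nat -> Type :=
| RZero k : rfun O k
| RSucc : rfun O 1
| RProj k (i : 'I_k) : rfun O k
| ROracle (o : O) : rfun O 1
| RComp k m (g : rfun O m) (h : 'I_m -> rfun O k) : rfun O k
| RPrec k (g : rfun O k) (h : rfun O k.+2) : rfun O k.+1
| RMu k (g : rfun O k.+1) : rfun O k.

(* Graph of the partial function n |-> F n with F 0 = G and
   F n.+1 = H n (F n), where G and H are themselves graphs. *)
Fixpoint prec_eval (G : nat -> Prop) (H : nat -> nat -> nat -> Prop)
    (n y : nat) : Prop :=
  if n is n'.+1 then exists z, prec_eval G H n' z /\ H n' z y else G y.

(* [reval f c v y]: with oracles f, the function with code c converges on v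
   with value y.  Minimization requires convergence at all smaller arguments. *)
Fixpoint reval (O : Type) (f : O -> nat -> nat) (k : nat) (c : rfun O k) :
    k.-tuple nat -> nat -> Prop :=
  match c in rfun _ k return k.-tuple nat -> nat -> Prop with
  | RZero _ => fun _ y => y = 0
  | RSucc => fun v y => y = (thead v).+1
  | RProj _ i => fun v y => y = tnth v i
  | ROracle o => fun v y => y = f o (thead v)
  | RComp _ m g h => fun v y => exists w : m.-tuple nat,
      (forall i, reval f (h i) v (tnth w i)) /\ reval f g w y
  | RPrec _ g h => fun v y =>
      prec_eval (reval f g (behead_tuple v))
        (fun n z => reval f h (cons_tuple n (cons_tuple z (behead_tuple v))))
        (thead v) y
  | RMu _ g => fun v y =>
      reval f g (cons_tuple y v) 0 /\
      forall i, i < y -> exists z, reval f g (cons_tuple i v) z.+1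
  end.

Definition computable (g : nat -> nat) : Prop :=
  exists c : rfun void 1,
    forall n, reval (of_void (nat -> nat)) c [tuple n] (g n).

Definition computable_in (f g : nat -> nat) : Prop :=
  exists c : rfun unit 1, forall n, reval (fun=> f) c [tuple n] (g n).

Definition computes (f : nat -> nat) (A : set nat) : Prop :=
  computable_in f (fun n => nat_of_bool `[< A n >]).

Definition ce (W : set nat) : Prop :=
  W = set0 \/ exists g : nat -> nat, computable g /\ W = range g.

(* Cantor's pairing <u, n>. *)
Definition cpair (u n : nat) : nat := ((u + n) * (u + n).+1)./2 + u.

(* D_u, the finite set with canonical index u = \sum_(i in D_u) 2 ^ i. *)
Definition canonical_set (u : nat) : set nat := [set i | odd (u %/ 2 ^ i)].

Definition enum_apply (Theta X : set nat) : set nat :=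
  [set n | exists u, canonical_set u `<=` X /\ Theta (cpair u n)].

Definition enum_reducible (A X : set nat) : Prop :=
  exists Theta : set nat, ce Theta /\ A = enum_apply Theta X.

Definition introenumerable (A : set nat) : Prop :=
  infinite_set A /\
  forall C : set nat, infinite_set C -> C `<=` A -> enum_reducible A C.

(* The x in A with exactly n elements of A below it; indices start at 0, and
   the value is the default 0 when A has at most n elements. *)
Definition principal (A : set nat) (n : nat) : nat :=
  xget 0 [set x | A x /\ count (fun i => `[< A i >]) (iota 0 x) = n].

Definition majorreducible (A : set nat) : Prop :=
  forall f : nat -> nat, (forall n, principal A n <= f n) -> computes f A.

(* Main.v *)
(** Let [f] majorize the principal function of [A].  The infinite subsets [C] of
    [A] that meet every interval [[j, f j]] form a compact class, Pi^0_1 in [f],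
    which contains [A].  Go through all enumeration operators Theta and shrink
    this class so that [Theta(C) <> A] on it, either by requiring a finite set to
    be included in [C] or by excluding the finite sets that put some [n] into
    [Theta(C)].  If this always succeeded, a point of the intersection would
    contradict introenumerability.  So at some condition [Theta(C) = A] holds for
    all [C] in a nonempty class; then [m] lies in [A] iff excluding [m] from
    [Theta(C)] empties the class, which by compactness is c.e. in [f].  As the
    complement of [A] is c.e., [f] computes [A]. *)

Require Import Defs.
From mathcomp Require Import all_boot.
From mathcomp Require Import boolp classical_sets functions cardinality.
Set Implicit Arguments.
Unset Strict Implicit.
Unset Printing Implicit Defensive.
Local Open Scope classical_set_scope.

(** * Total functions recursive in oracles, and their closure properties *)

Lemma thead_cons (T : Type) n (x : T) (v : n.-tuple T) :
  thead (cons_tuple x v) = x.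
Proof. exact: theadE. Qed.

Lemma behead_cons (T : Type) n (x : T) (v : n.-tuple T) :
  behead_tuple (cons_tuple x v) = v.
Proof. exact: val_inj. Qed.

(** Scanning [i < u] is enough: a bit [i] of [u] forces [2 ^ i <= u], hence [i < u]. The bound makes
    inclusion a bounded, hence recursive, test. *)
Definition canonical_subset (u w : nat) : bool :=
  all (fun i => odd (u %/ 2 ^ i) ==> odd (w %/ 2 ^ i)) (iota 0 u).

Section TotalRecursive.
Variables (O : Type) (f : O -> nat -> nat).

Definition recursive k (F : k.-tuple nat -> nat) : Prop :=
  exists c : rfun O k, forall v, reval f c v (F v).

Definition recursiveb k (B : k.-tuple nat -> bool) : Prop :=
  recursive (fun v => nat_of_bool (B v)).

Lemma eq_recursive k (F G : k.-tuple nat -> nat) :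
  F =1 G -> recursive F -> recursive G.
Proof. by move=> FG [c Hc]; exists c => v; rewrite -FG. Qed.

Lemma eq_recursiveb k (B1 B2 : k.-tuple nat -> bool) :
  B1 =1 B2 -> recursiveb B1 -> recursiveb B2.
Proof. by move=> B12; apply: eq_recursive => v; rewrite B12. Qed.

Lemma recursive_proj k (i : 'I_k) : recursive (fun v => tnth v i).
Proof. by exists (RProj O i). Qed.

Lemma recursive_comp k m (G : m.-tuple nat -> nat)
    (H : 'I_m -> k.-tuple nat -> nat) :
  recursive G -> (forall i, recursive (H i)) ->
  recursive (fun v => G (mktuple (fun i => H i v))).
Proof.
move=> [g Hg] /choice[h Hh]; exists (RComp g h) => v /=.
exists (mktuple (fun i => H i v)); split=> // i.
by rewrite tnth_mktuple.
Qed.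

Lemma recursive_weaken k (F : k.-tuple nat -> nat) :
  recursive F -> recursive (fun w : k.+1.-tuple nat => F (behead_tuple w)).
Proof.
move=> rF.
have := recursive_comp rF (fun i => @recursive_proj k.+1 (lift ord0 i)).
apply: eq_recursive => v; congr F; apply: eq_from_tnth => i.
by rewrite tnth_mktuple [in LHS](tuple_eta v) tnthS.
Qed.

Lemma recursive_subst k (F : k.+1.-tuple nat -> nat) N :
  recursive F -> recursive N -> recursive (fun v => F (cons_tuple (N v) v)).
Proof.
move=> rF rN.
have rH (i : 'I_k.+1) :
    recursive (fun v : k.-tuple nat => tnth (cons_tuple (N v) v) i).
  case: (unliftP ord0 i) => [j|] ->.
    by apply: eq_recursive (recursive_proj j) => v; rewrite tnthS.
  by apply: eq_recursive rN => v; rewrite tnth0.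
apply: eq_recursive (recursive_comp rF rH) => v; congr F.
by apply: eq_from_tnth => i; rewrite tnth_mktuple.
Qed.

Lemma recursive_app1 k (F : nat -> nat) (a : k.-tuple nat -> nat) :
  recursive (fun v : 1.-tuple nat => F (thead v)) -> recursive a ->
  recursive (fun v => F (a v)).
Proof.
move=> rF ra.
apply: eq_recursive (recursive_comp rF (fun=> ra)) => v; congr F.
by rewrite /thead tnth_mktuple.
Qed.

Lemma recursive_app2 k (F : nat -> nat -> nat) (a b : k.-tuple nat -> nat) :
  recursive (fun v : 2.-tuple nat => F (thead v) (thead (behead_tuple v))) ->
  recursive a -> recursive b -> recursive (fun v => F (a v) (b v)).
Proof.
move=> rF ra rb.
have rH (i : 'I_2) : recursive (fun v => tnth [tuple a v; b v] i).
  case: (unliftP ord0 i) => [j|] ->; last exact: eq_recursive ra.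
  by rewrite ord1; apply: eq_recursive rb.
apply: eq_recursive (recursive_comp rF rH) => v.
have -> : mktuple (fun i => tnth [tuple a v; b v] i) = [tuple a v; b v].
  by apply: eq_from_tnth => i; rewrite tnth_mktuple.
by [].
Qed.

Lemma recursiveb_app2 k (R : nat -> nat -> bool)
    (a b : k.-tuple nat -> nat) :
  recursiveb (fun v : 2.-tuple nat => R (thead v) (thead (behead_tuple v))) ->
  recursive a -> recursive b -> recursiveb (fun v => R (a v) (b v)).
Proof. exact: (@recursive_app2 _ (fun x y => R x y : nat)). Qed.

Lemma recursive_var0 k : recursive (fun w : k.+1.-tuple nat => thead w).
Proof. exact: recursive_proj. Qed.

Lemma recursive_var1 k :
  recursive (fun w : k.+2.-tuple nat => thead (behead_tuple w)).
Proof. exact: (recursive_weaken (@recursive_var0 k)). Qed.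

Lemma recursive_var2 k :
  recursive (fun w : k.+3.-tuple nat => thead (behead_tuple (behead_tuple w))).
Proof. exact: (recursive_weaken (@recursive_var1 k)). Qed.

Lemma recursive_var3 k :
  recursive (fun w : k.+4.-tuple nat =>
    thead (behead_tuple (behead_tuple (behead_tuple w)))).
Proof. exact: (recursive_weaken (@recursive_var2 k)). Qed.

Lemma recursive_var4 k :
  recursive (fun w : k.+4.+1.-tuple nat =>
    thead (behead_tuple (behead_tuple (behead_tuple (behead_tuple w))))).
Proof. exact: (recursive_weaken (@recursive_var3 k)). Qed.

Lemma recursive_oracle k o (F : k.-tuple nat -> nat) :
  recursive F -> recursive (fun v => f o (F v)).
Proof. by apply: recursive_app1; exists (ROracle o). Qed.

Lemma recursive_succ k (F : k.-tuple nat -> nat) :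
  recursive F -> recursive (fun v => (F v).+1).
Proof. by apply: recursive_app1; exists (RSucc O). Qed.

Lemma recursive_cst k n : recursive (fun _ : k.-tuple nat => n).
Proof.
by elim: n => [|n IHn]; [exists (RZero O k) | exact: recursive_succ].
Qed.

Lemma recursive_prec k (H : nat -> nat -> k.-tuple nat -> nat)
    (G N : k.-tuple nat -> nat) :
  recursive G -> recursive N ->
  recursive (fun w : k.+2.-tuple nat =>
    H (thead w) (thead (behead_tuple w)) (behead_tuple (behead_tuple w))) ->
  recursive (fun v => nat_rect (fun=> nat) (G v) (fun n z => H n z v) (N v)).
Proof.
move=> [g Hg] rN [h Hh].
(* [RPrec] recurses on its head argument, so the recursion is first built with the counter as an
   extra head variable; [N v] is substituted for it afterwards. *)
have rF : recursive (fun w : k.+1.-tuple nat =>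
    nat_rect (fun=> nat) (G (behead_tuple w))
      (fun n z => H n z (behead_tuple w)) (thead w)).
  exists (RPrec g h) => v /=; elim: (thead v) => [|n IHn] /=; first exact: Hg.
  eexists; split; first exact: IHn.
  by have := Hh (cons_tuple n (cons_tuple (nat_rect (fun=> nat)
      (G (behead_tuple v)) (fun n z => H n z (behead_tuple v)) n)
      (behead_tuple v))); rewrite !(behead_cons, thead_cons).
apply: eq_recursive (recursive_subst rF rN) => v.
by rewrite behead_cons thead_cons.
Qed.

(** Since [F] is total and a zero always exists, unbounded search yields a total function, the least
    zero. *)
Lemma recursive_mu k (F : k.+1.-tuple nat -> nat) :
  recursive F -> (forall v, exists y, F (cons_tuple y v) == 0) ->
  exists2 G, recursive G & forall v, F (cons_tuple (G v) v) = 0.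
Proof.
move=> [c Hc] exF; exists (fun v => ex_minn (exF v)) => [|v]; last first.
  by case: ex_minnP => y /eqP.
exists (RMu c) => v /=; case: ex_minnP => y /eqP y0 ymin; split.
  by rewrite -y0.
move=> i iy; exists (F (cons_tuple i v)).-1; rewrite prednK //.
by rewrite lt0n; apply: contraL iy => /ymin; rewrite -leqNgt.
Qed.

Lemma recursive_add k (F G : k.-tuple nat -> nat) :
  recursive F -> recursive G -> recursive (fun v => F v + G v).
Proof.
move=> rF rG.
have := recursive_prec (H := fun _ z _ => z.+1) rF rG
  (recursive_succ (recursive_var1 k)).
by apply: eq_recursive => v; elim: (G v) => [|n /= ->]; rewrite ?addn0 ?addnS.
Qed.

Lemma recursive_mul k (F G : k.-tuple nat -> nat) :
  recursive F -> recursive G -> recursive (fun v => F v * G v).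
Proof.
move=> rF rG.
have := recursive_prec (H := fun _ z v => F v + z) (recursive_cst k 0) rG
  (recursive_add (recursive_weaken (recursive_weaken rF)) (recursive_var1 k)).
by apply: eq_recursive => v; elim: (G v) => [|n /= ->]; rewrite ?muln0 ?mulnS.
Qed.

Lemma recursive_pred k (F : k.-tuple nat -> nat) :
  recursive F -> recursive (fun v => (F v).-1).
Proof.
move=> rF.
have := recursive_prec (H := fun n _ _ => n) (recursive_cst k 0) rF
  (recursive_var0 k.+1).
by apply: eq_recursive => v; case: (F v).
Qed.

Lemma recursive_sub k (F G : k.-tuple nat -> nat) :
  recursive F -> recursive G -> recursive (fun v => F v - G v).
Proof.
move=> rF rG.
have := recursive_prec (H := fun _ z _ => z.-1) rF rG
  (recursive_pred (recursive_var1 k)).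
by apply: eq_recursive => v; elim: (G v) => [|n /= ->]; rewrite ?subn0 ?subnS.
Qed.

Lemma recursive_exp2 k (F : k.-tuple nat -> nat) :
  recursive F -> recursive (fun v => 2 ^ F v).
Proof.
move=> rF.
have := recursive_prec (H := fun _ z _ => z + z) (recursive_cst k 1) rF
  (recursive_add (recursive_var1 k) (recursive_var1 k)).
apply: eq_recursive => v; elim: (F v) => [|n /= ->] //.
by rewrite expnS mul2n addnn.
Qed.

Lemma recursiveb_not k (B : k.-tuple nat -> bool) :
  recursiveb B -> recursiveb (fun v => ~~ B v).
Proof.
move=> rB; apply: eq_recursive (recursive_sub (recursive_cst k 1) rB) => v.
by case: (B v).
Qed.

Lemma recursiveb_and k (B1 B2 : k.-tuple nat -> bool) :
  recursiveb B1 -> recursiveb B2 -> recursiveb (fun v => B1 v && B2 v).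
Proof.
by move=> r1 r2; apply: eq_recursive (recursive_mul r1 r2) => v; rewrite mulnb.
Qed.

Lemma recursiveb_or k (B1 B2 : k.-tuple nat -> bool) :
  recursiveb B1 -> recursiveb B2 -> recursiveb (fun v => B1 v || B2 v).
Proof.
move=> r1 r2; apply: eq_recursiveb
  (recursiveb_not (recursiveb_and (recursiveb_not r1) (recursiveb_not r2))) => v.
by rewrite negb_and !negbK.
Qed.

Lemma recursiveb_imply k (B1 B2 : k.-tuple nat -> bool) :
  recursiveb B1 -> recursiveb B2 -> recursiveb (fun v => B1 v ==> B2 v).
Proof.
move=> r1 r2; apply: eq_recursiveb (recursiveb_or (recursiveb_not r1) r2) => v.
by rewrite implybE.
Qed.

Lemma recursiveb_leq k (F G : k.-tuple nat -> nat) :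
  recursive F -> recursive G -> recursiveb (fun v => F v <= G v).
Proof.
move=> rF rG; apply: eq_recursive
  (recursive_sub (recursive_cst k 1) (recursive_sub rF rG)) => v.
by rewrite -subn_eq0; case: (F v - G v) => [|[]].
Qed.

Lemma recursiveb_eq k (F G : k.-tuple nat -> nat) :
  recursive F -> recursive G -> recursiveb (fun v => F v == G v).
Proof.
move=> rF rG; apply: eq_recursiveb
  (recursiveb_and (recursiveb_leq rF rG) (recursiveb_leq rG rF)) => v.
by rewrite eqn_leq.
Qed.

Lemma recursiveb_odd k (F : k.-tuple nat -> nat) :
  recursive F -> recursiveb (fun v => odd (F v)).
Proof.
move=> rF.
have := recursive_prec (H := fun _ z _ => 1 - z) (recursive_cst k 0) rF
  (recursive_sub (recursive_cst _ 1) (recursive_var1 k)).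
by apply: eq_recursive => v; elim: (F v) => [|n /= ->] //=; case: (odd n).
Qed.

Lemma recursive_half k (F : k.-tuple nat -> nat) :
  recursive F -> recursive (fun v => (F v)./2).
Proof.
move=> rF.
(* Halving advances exactly at odd numbers: [n.+1./2 = odd n + n./2]. *)
have := recursive_prec (H := fun n z _ => odd n + z) (recursive_cst k 0) rF
  (recursive_add (recursiveb_odd (recursive_var0 _)) (recursive_var1 k)).
apply: eq_recursive => v; elim: (F v) => [|n /= ->] //.
by rewrite uphalf_half.
Qed.

Lemma recursive_div_exp2 k (F G : k.-tuple nat -> nat) :
  recursive F -> recursive G -> recursive (fun v => F v %/ 2 ^ G v).
Proof.
move=> rF rG.
have := recursive_prec (H := fun _ z _ => z./2) rF rG
  (recursive_half (recursive_var1 k)).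
apply: eq_recursive => v; elim: (G v) => [|n /= ->]; first by rewrite divn1.
by rewrite -divn2 -divnMA -expnSr.
Qed.

Lemma recursiveb_all k (B : nat -> k.-tuple nat -> bool)
    (N : k.-tuple nat -> nat) :
  recursive N ->
  recursiveb (fun w : k.+1.-tuple nat => B (thead w) (behead_tuple w)) ->
  recursiveb (fun v => all (fun i => B i v) (iota 0 (N v))).
Proof.
move=> rN rB.
(* The recursion step also receives the accumulator, which [B] must not see; composing with
   projections drops it. *)
have rB' : recursive (fun w : k.+2.-tuple nat =>
    (B (thead w) (behead_tuple (behead_tuple w)) : nat)).
  have rH (i : 'I_k.+1) : recursive (fun w : k.+2.-tuple nat =>
      tnth (cons_tuple (thead w) (behead_tuple (behead_tuple w))) i).
    case: (unliftP ord0 i) => [j|] ->.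
      apply: eq_recursive (recursive_weaken (recursive_weaken (recursive_proj j))).
      by move=> w; rewrite tnthS.
    by apply: eq_recursive (recursive_var0 _) => w; rewrite tnth0.
  apply: eq_recursive (recursive_comp rB rH) => w.
  rewrite (_ : mktuple _ = cons_tuple (thead w) (behead_tuple (behead_tuple w))).
    by rewrite thead_cons behead_cons.
  by apply: eq_from_tnth => i; rewrite tnth_mktuple.
have := recursive_prec (H := fun n z v => B n v * z) (recursive_cst k 1) rN
  (recursive_mul rB' (recursive_var1 k)).
apply: eq_recursive => v; elim: (N v) => [|n IHn] //.
by rewrite [LHS]/= IHn -[in RHS](addn1 n) iotaD all_cat /= andbT add0n mulnb andbC.
Qed.

Lemma recursiveb_has k (B : nat -> k.-tuple nat -> bool)
    (N : k.-tuple nat -> nat) :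
  recursive N ->
  recursiveb (fun w : k.+1.-tuple nat => B (thead w) (behead_tuple w)) ->
  recursiveb (fun v => has (fun i => B i v) (iota 0 (N v))).
Proof.
move=> rN rB; apply: eq_recursiveb
  (recursiveb_not (recursiveb_all rN (recursiveb_not rB))) => v.
by rewrite -[RHS]negbK -all_predC.
Qed.

Lemma recursive_cpair k (F G : k.-tuple nat -> nat) :
  recursive F -> recursive G -> recursive (fun v => cpair (F v) (G v)).
Proof.
move=> rF rG; have rFG := recursive_add rF rG.
by apply: recursive_add rF; apply/recursive_half/recursive_mul/recursive_succ.
Qed.

Lemma recursiveb_canonical_subset k (F G : k.-tuple nat -> nat) :
  recursive F -> recursive G ->
  recursiveb (fun v => canonical_subset (F v) (G v)).
Proof.
move=> rF rG; apply: recursiveb_all => //.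
have var F' : recursive F' -> recursiveb (fun w : k.+1.-tuple nat =>
    odd (F' (behead_tuple w) %/ 2 ^ thead w)).
  move=> rF'; apply: recursiveb_odd; apply: recursive_div_exp2.
    exact: recursive_weaken.
  exact: recursive_var0.
by apply: recursiveb_imply; apply: var.
Qed.

End TotalRecursive.

(** * Oracle-free codes: relativization, single-valuedness, and a listing of the c.e. sets *)

Fixpoint relativize O (c0 : void -> O) k (c : rfun void k) : rfun O k :=
  match c in rfun _ k return rfun O k with
  | RZero k => RZero O k
  | RSucc => RSucc O
  | RProj k i => RProj O i
  | ROracle o => ROracle (c0 o)
  | RComp k m g h => RComp (relativize c0 g) (fun i => relativize c0 (h i))
  | RPrec k g h => RPrec (relativize c0 g) (relativize c0 h)
  | RMu k g => RMu (relativize c0 g)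
  end.

Lemma sub_prec_eval (G G' : nat -> Prop) (H H' : nat -> nat -> nat -> Prop) :
  (forall y, G y -> G' y) -> (forall n z y, H n z y -> H' n z y) ->
  forall n y, prec_eval G H n y -> prec_eval G' H' n y.
Proof.
move=> GG' HH'; elim=> [|n IHn] y /=; first exact: GG'.
by case=> z [/IHn ? /HH' ?]; exists z.
Qed.

Lemma reval_relativize O (f : O -> nat -> nat) c0 k (c : rfun void k) v y :
  reval (of_void (nat -> nat)) c v y -> reval f (relativize c0 c) v y.
Proof.
elim: c v y => {k} [||||k m g IHg h IHh|k g IHg h IHh|k g IHg] //= v y.
- by move=> [w [Hh Hg]]; exists w; split=> [i|]; [exact: IHh | exact: IHg].
- by apply: sub_prec_eval => *; [exact: IHg | exact: IHh].
- case=> Hy Hi; split=> [|i /Hi[z ?]]; first exact: IHg.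
  by exists z; apply: IHg.
Qed.

Lemma computable_recursive O (f : O -> nat -> nat) g :
  computable g -> recursive f (fun v : 1.-tuple nat => g (thead v)).
Proof.
move=> [c Hc]; exists (relativize (of_void O) c) => v.
apply: reval_relativize; have := Hc (thead v); congr reval.
by apply: eq_from_tnth => i; rewrite ord1 !tnth0.
Qed.

Lemma prec_eval_functional (G : nat -> Prop) (H : nat -> nat -> nat -> Prop) :
  (forall y y', G y -> G y' -> y = y') ->
  (forall n z y y', H n z y -> H n z y' -> y = y') ->
  forall n y y', prec_eval G H n y -> prec_eval G H n y' -> y = y'.
Proof.
move=> GG HH; elim=> [|n IHn] y y' /=; first exact: GG.
by move=> [z [Hz Hy]] [z' [/IHn-/(_ _ Hz) -> Hy']]; apply: HH Hy Hy'.
Qed.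

Lemma reval_functional O (f : O -> nat -> nat) k (c : rfun O k) v y y' :
  reval f c v y -> reval f c v y' -> y = y'.
Proof.
elim: c v y y' => {k} [k||k i|o|k m g IHg h IHh|k g IHg h IHh|k g IHg] v y y' /=;
  try by move=> -> ->.
- move=> [w [Hh Hg]] [w' [Hh' Hg']]; suff ww : w = w'.
    by apply: IHg Hg _; rewrite ww.
  by apply: eq_from_tnth => i; apply: IHh (Hh i) (Hh' i).
- by apply: prec_eval_functional => *;
    [apply: IHg; eassumption | apply: IHh; eassumption].
(* Of two distinct results of a minimization, the smaller would be both a zero and an argument with
   a positive value. *)
- move=> [Hy Hi] [Hy' Hi']; case: (ltngtP y y') => // lt.
  + by have [z /(IHg _ _ _ Hy)] := Hi' _ lt.
  + by have [z /(IHg _ _ _ Hy')] := Hi _ lt.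
Qed.

(** Generic trees are countable, so decoding them shows that codes are too. Arities are passed in
    from outside, which avoids dependent types in the trees; malformed trees decode to the zero
    function. Labels 0, 1 and 2 are taken, so a composition through [m] functions has label
    [m.+3]. *)
Fixpoint decode_rfun O (t : GenTree.tree nat) : forall k, rfun O k :=
  match t with
  | GenTree.Leaf i => fun k => oapp (@RProj O k) (RZero O k) (insub i)
  | GenTree.Node n ts =>
    let d i := nth (RZero O) [seq decode_rfun O t | t <- ts] i in
    match n with
    | 0 => fun k => match k with 1 => RSucc O | k => RZero O k end
    | 1 => fun k => match k with
                    | k'.+1 => RPrec (d 0 k') (d 1 k'.+2)
                    | 0 => RZero O 0 end
    | 2 => fun k => RMu (d 0 k.+1)
    | m.+3 => fun k => RComp (d 0 m) (fun i : 'I_m => d i.+1 k)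
    end
  end.

Lemma decode_rfun_surj k (c : rfun void k) :
  exists t, decode_rfun void t k = c.
Proof.
elim: c => {k} [k||k i|//|k m g [tg Hg] h /choice[th Hh]
  |k g [tg Hg] h [th Hh]|k g [tg Hg]].
(* The leaf [k] is out of range as a projection index of arity [k], so it falls back to zero. *)
- by exists (GenTree.Leaf k) => /=; rewrite insubF // ltnn.
- by exists (GenTree.Node 0 [::]).
- by exists (GenTree.Leaf (i : nat)) => /=; rewrite valK.
- exists (GenTree.Node m.+3 (tg :: [seq th i | i <- enum 'I_m])) => /=.
  rewrite Hg; congr RComp; apply: funext => i.
  by rewrite -map_comp (nth_map i) ?size_enum_ord // nth_ord_enum /= Hh.
- by exists (GenTree.Node 1 [:: tg; th]) => /=; rewrite Hg Hh.
- by exists (GenTree.Node 2 [:: tg]) => /=; rewrite Hg.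
Qed.

(** The listing need not be effective. Index 0 gives the empty set; the others give ranges of
    possibly partial functions, and all that matters is that every c.e. set occurs. *)
Lemma ce_enumeration :
  exists W : nat -> set nat, forall V, ce V -> exists e, V = W e.
Proof.
pose code e := decode_rfun void (odflt (GenTree.Leaf 0) (unpickle e)) 1.
pose dom e := [set y | exists n, reval (of_void (nat -> nat)) (code e) [tuple n] y].
exists (fun e => if e is e'.+1 then dom e' else set0) => V.
case=> [->|[g [[c Hc] ->]]]; first by exists 0.
have [t Ht] := decode_rfun_surj c.
have Et : code (pickle t) = c by rewrite /code pickleK.
exists (pickle t).+1; rewrite /dom Et.
apply/seteqP; split=> y /= [n].
  by move=> _ <-; exists n.
by move=> Hy; exists n => //; apply: reval_functional (Hc n) Hy.
Qed.

(** * Compactness of Cantor space *)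

Definition agree (n : nat) (C C' : set nat) : Prop :=
  forall i, i < n -> (C i <-> C' i).

(* Closedness in Cantor space. *)
Definition prefix_closed (Q : set (set nat)) : Prop :=
  forall C, (forall n, exists2 C', Q C' & agree n C C') -> Q C.

Lemma agree_sym n C C' : agree n C C' -> agree n C' C.
Proof. by move=> H i /H H'; split=> /H'. Qed.

Lemma agree_trans n C1 C2 C3 : agree n C1 C2 -> agree n C2 C3 -> agree n C1 C3.
Proof. by move=> H H' i Hi; split=> [/(H i Hi)/(H' i Hi)|/(H' i Hi)/(H i Hi)]. Qed.

Lemma prefix_closed_finite (Q : set (set nat)) n :
  (forall C C', agree n C C' -> Q C -> Q C') -> prefix_closed Q.
Proof.
by move=> QQ C /(_ n)[C' QC' CC']; apply: QQ QC'; apply: agree_sym CC'.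
Qed.

(** König's lemma: a path is built bit by bit through the prefixes that extend to a member of every
    [Q s]. Closedness puts the limit of the path into each [Q s]. *)
Lemma nested_prefix_closed (Q : nat -> set (set nat)) :
  (forall s, prefix_closed (Q s)) -> (forall s, Q s.+1 `<=` Q s) ->
  (forall s, Q s !=set0) -> exists C, forall s, Q s C.
Proof.
move=> Qclosed Qdecr Qn0.
have Qle s s' : s <= s' -> Q s' `<=` Q s.
  by move/subnKC <-; elim: (s' - s) => [|n IHn];
    rewrite ?addn0 ?addnS // => C /Qdecr/IHn.
pose good n C := forall s, exists2 C', Q s C' & agree n C C'.
have step (p : nat * set nat) : exists C', good p.1 p.2 ->
    good p.1.+1 C' /\ agree p.1 p.2 C'.
  case: p => n C /=; have [gC|] := pselect (good n C); last by exists C.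
  pose ext (b : Prop) : set nat := [set i | if i < n then C i else b].
  have extC b : agree n C (ext b) by move=> i lt; rewrite /ext /mkset lt.
  apply: contrapT => no.
  have bad b : exists s, ~ exists2 C', Q s C' & agree n.+1 (ext b) C'.
    by apply/existsNP => gb; apply: no; exists (ext b).
  have [[sT hT] [sF hF]] := (bad True, bad False).
  (* If both one-bit extensions died, at stages [sT] and [sF], a member of the later class extending
     the prefix would still realize one of them. *)
  have [C' QC' CC'] := gC (maxn sT sF).
  have agr b : (b <-> C' n) -> agree n.+1 (ext b) C'.
    move=> bn i; rewrite ltnS leq_eqVlt => /predU1P[->|lt];
      rewrite /ext /mkset ?ltnn // lt.
    exact: CC'.
  have [Cn|Cn] := pselect (C' n).
    by apply: hT; exists C'; [apply: Qle QC'; rewrite leq_maxl | apply: agr].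
  by apply: hF; exists C'; [apply: Qle QC'; rewrite leq_maxr | apply: agr].
have {step}[next Hnext] := choice step.
pose X := nat_rect (fun=> set nat) set0 (fun n C => next (n, C)).
have goodX n : good n (X n).
  by elim: n => [|n /(Hnext (n, _))[]] // s; have [C QC] := Qn0 s; exists C.
have agrX n m : agree n (X n) (X (n + m)).
  elim: m => [|m IHm]; first by rewrite addn0.
  apply: agree_trans IHm _; rewrite addnS => i lt.
  have [_ /(_ i)] := Hnext (n + m, X (n + m)) (goodX _).
  by apply; rewrite (leq_trans lt) ?leq_addr.
(* Bit [i] is settled once the prefix has length [i.+1], so the limit is read off diagonally. *)
pose C : set nat := [set i | X i.+1 i].
exists C => s; apply: Qclosed => n; have [C' QC' CC'] := goodX n s.
exists C' => //; apply: agree_trans CC' => i lt.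
by have := agrX i.+1 (n - i.+1) i; rewrite subnKC //; apply.
Qed.

(** * Canonical indices of finite sets *)

Lemma canonical_set_lt u i : canonical_set u i -> i < u.
Proof.
rewrite /canonical_set /=; case: ltnP => // le; rewrite divn_small //.
exact: leq_ltn_trans le (ltn_expl _ _).
Qed.

Lemma canonical_set_lt_exp2 s u i : u < 2 ^ s -> canonical_set u i -> i < s.
Proof.
move=> lt; rewrite /canonical_set /=; case: (ltnP i s) => // le.
rewrite divn_small //.
by rewrite (leq_trans lt) // leq_exp2l.
Qed.

Lemma canonical_set_exp2 x : canonical_set (2 ^ x) = [set x].
Proof.
apply/seteqP; split=> i; rewrite /canonical_set /=; last first.
  by move=> ->; rewrite divnn expn_gt0.
case: (ltngtP i x) => // lt; last by rewrite divn_small // ltn_exp2l.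
rewrite -(subnK (ltnW lt)) expnD mulnK ?expn_gt0 // oddX /=.
by rewrite subn_eq0 leqNgt lt.
Qed.

Lemma canonical_subsetP u w :
  reflect (canonical_set u `<=` canonical_set w) (canonical_subset u w).
Proof.
apply: (iffP allP) => [H i Hi|H i _]; last by apply/implyP/H.
apply: (implyP _ Hi); apply: H.
by rewrite mem_iota; apply: canonical_set_lt Hi.
Qed.

Lemma agree_canonical_subset n u C C' : u <= n -> agree n C C' ->
  canonical_set u `<=` C -> canonical_set u `<=` C'.
Proof.
move=> un CC' uC i Hi; have lt := canonical_set_lt Hi.
by apply/CC'; [apply: leq_trans un | apply: uC].
Qed.

Lemma canonical_code s (C : set nat) :
  exists2 u, u < 2 ^ s & agree s (canonical_set u) C.
Proof.
elim: s C => [|s IHs] C; first by exists 0.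
have [u lt Hu] := IHs [set i | C i.+1].
(* The lowest bit records [C 0]; doubling shifts the code of the remaining bits by one place. *)
exists (`[< C 0 >] + u.*2).
  rewrite expnS mul2n; apply: (@leq_ltn_trans (1 + u.*2)).
    by rewrite leq_add2r leq_b1.
  by rewrite add1n ltn_Sdouble.
case=> [|i] lti; rewrite /canonical_set /=.
  by rewrite divn1 oddD odd_double addbF oddb; split=> /asboolP.
by rewrite expnS divnMA divn2 half_bit_double; apply: Hu.
Qed.

Lemma canonical_setU d u :
  exists w, canonical_set w = canonical_set d `|` canonical_set u.
Proof.
have [w lt Hw] := canonical_code (d + u) (canonical_set d `|` canonical_set u).
exists w; apply/seteqP; split=> i Hi.
  by apply/Hw => //; apply: canonical_set_lt_exp2 Hi.
apply/Hw => //; case: Hi => /canonical_set_lt lti; apply: leq_trans lti _.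
  exact: leq_addr.
exact: leq_addl.
Qed.

(** * Forcing classes and their finite-stage approximations *)

Definition forcing_class (f : nat -> nat) (d : nat) (E : set nat) :
    set (set nat) :=
  [set C | [/\ canonical_set d `<=` C,
    forall j, exists2 x, j <= x <= f j & C x &
    forall u, E u -> ~ canonical_set u `<=` C]].

(** Infinitude alone is not a closed condition. Bounding the next element by [f j] makes it one:
    each requirement, for a fixed [j] or a fixed forbidden [u], looks at finitely many bits. *)
Lemma prefix_closed_forcing_class f d E : prefix_closed (forcing_class f d E).
Proof.
move=> C HC; split=> [|j|u Eu uC].
- have [C' [dC' _ _] CC'] := HC d.
  exact: agree_canonical_subset (leqnn d) (agree_sym CC') dC'.
- have [C' [_ /(_ j)[x jx C'x] _] CC'] := HC (f j).+1.
  by exists x => //; apply/CC' => //; case/andP: jx.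
- have [C' [_ _ C'E] CC'] := HC u; apply: (C'E u Eu).
  exact: agree_canonical_subset (leqnn u) CC' uC.
Qed.

Definition sigma1 (f : nat -> nat) (E : set nat) : Prop :=
  exists2 R : nat -> nat -> bool,
    recursiveb (fun _ : unit => f)
      (fun v : 2.-tuple nat => R (thead v) (thead (behead_tuple v))) &
    E = [set u | exists s, R u s].

Lemma ce_sigma1 f W : ce W -> sigma1 f W.
Proof.
case=> [->|[g [/(computable_recursive (fun _ : unit => f)) rg ->]]].
  exists (fun _ _ => false); first exact: recursive_cst.
  by apply/seteqP; split=> // u [].
exists (fun u s => g s == u).
  apply: recursiveb_eq (recursive_var0 _ _).
  by apply: recursive_app1 rg _; apply: recursive_var1.
by apply/seteqP; split=> u [s] => [_ <-|/eqP <-]; exists s.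
Qed.

(** As [2 ^ x] is the index of the singleton of [x], forbidding these indices keeps [C] disjoint
    from [W]. *)
Lemma ce_sigma1_exp2 f W : ce W -> sigma1 f [set u | exists2 x, W x & u = 2 ^ x].
Proof.
case=> [->|[g [/(computable_recursive (fun _ : unit => f)) rg ->]]].
  exists (fun _ _ => false); first exact: recursive_cst.
  by apply/seteqP; split=> u [].
exists (fun u s => 2 ^ g s == u).
  apply: recursiveb_eq (recursive_var0 _ _); apply: recursive_exp2.
  by apply: recursive_app1 rg _; apply: recursive_var1.
apply/seteqP; split=> u.
  by move=> [_ [s _ <-] ->]; exists s.
by move=> [s /eqP <-]; exists (g s) => //; exists s.
Qed.

(** The added indices are the axioms of [W] for [n]; forbidding them all keeps [n] out of [W(C)]. *)
Lemma sigma1_setU_cpair f E W n : sigma1 f E -> sigma1 f W ->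
  sigma1 f (E `|` [set u | W (cpair u n)]).
Proof.
move=> [R rR ->] [RW rW ->]; exists (fun u s => R u s || RW (cpair u n) s).
  apply: recursiveb_or => //; apply: recursiveb_app2 rW _ (recursive_var1 _ _).
  exact: recursive_cpair (recursive_var0 _ _) (recursive_cst _ _ n).
apply/seteqP; split=> u.
  by case=> -[s Rs]; exists s; rewrite Rs ?orbT.
by case=> s /orP[]; [left | right]; exists s.
Qed.

(* The part of membership of [canonical_set w] in [forcing_class f d E] that
   is visible at stage s, when E u holds iff R u j for some j. *)
Definition stage_test f d (R : nat -> nat -> bool) s w : bool :=
  [&& canonical_subset d w,
    all (fun j => (f j < s) ==>
      has (fun x => (j <= x) && odd (w %/ 2 ^ x)) (iota 0 (f j).+1)) (iota 0 s) &
    all (fun u => all (fun j => R u j ==> ~~ canonical_subset u w) (iota 0 s))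
      (iota 0 s)].

Definition stage_class f d (R : nat -> nat -> bool) s : set (set nat) :=
  [set C | [/\ canonical_set d `<=` C,
    forall j, j < s -> f j < s -> exists2 x, j <= x <= f j & C x &
    forall u j, u < s -> j < s -> R u j -> ~ canonical_set u `<=` C]].

Lemma stage_testP f d R s w :
  reflect (stage_class f d R s (canonical_set w)) (stage_test f d R s w).
Proof.
apply: (iffP and3P) => -[dw Hf HR]; split.
- exact/canonical_subsetP.
- move=> j js fjs.
  have /implyP/(_ fjs)/hasP[x] := allP Hf j (ltac:(by rewrite mem_iota)).
  by rewrite mem_iota => /andP[_ xf] /andP[jx wx]; exists x => //; rewrite jx.
- move=> u j us js Ruj /canonical_subsetP uw.
  have /allP/(_ j) := allP HR u (ltac:(by rewrite mem_iota)).
  by rewrite mem_iota Ruj uw => /(_ js).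
- exact/canonical_subsetP.
- apply/allP => j; rewrite mem_iota => /andP[_ js]; apply/implyP => fjs.
  have [x /andP[jx xf] wx] := Hf j js fjs.
  by apply/hasP; exists x; rewrite ?mem_iota // jx.
- apply/allP => u; rewrite mem_iota => /andP[_ us].
  apply/allP => j; rewrite mem_iota => /andP[_ js].
  by apply/implyP => Ruj; apply/canonical_subsetP/(HR u j).
Qed.

(** The guards confine everything inspected to the first [s + d] bits: witnesses satisfy
    [x <= f j < s], forbidden sets have [u < s], and elements of the set coded by [d] lie below
    [d]. *)
Lemma stage_class_agree f d R s C C' : agree (s + d) C C' ->
  stage_class f d R s C -> stage_class f d R s C'.
Proof.
move=> CC' [dC Cf CR]; split=> [|j js fjs|u j us js Ruj uC'].
- exact: agree_canonical_subset (leq_addl _ _) CC' dC.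
- have [x /andP[jx xf] Cx] := Cf j js fjs; exists x; first by rewrite jx.
  by apply/CC' => //; rewrite ltn_addr // (leq_ltn_trans xf).
- apply: (CR u j us js Ruj).
  by apply: agree_canonical_subset (agree_sym CC') uC'; rewrite ltnW // ltn_addr.
Qed.

(** The forcing class is the intersection of the decreasing, closed stage classes, so by compactness
    it is empty only if some stage is. Membership in stage [s] depends on [s + d] bits, so the codes
    below [2 ^ (s + d)] exhaust all cases. *)
Lemma forcing_class_empty f d (R : nat -> nat -> bool) :
  ~ (forcing_class f d [set u | exists j, R u j] !=set0) <->
  exists s, all (fun w => ~~ stage_test f d R s w) (iota 0 (2 ^ (s + d))).
Proof.
split=> [empty|[s /allP Hs] [C [dC Cf CR]]]; last first.
  have [w lt wC] := canonical_code (s + d) C.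
  have /(_ w) := Hs; rewrite mem_iota => /(_ lt)/negP; apply.
  apply/stage_testP; apply: stage_class_agree (agree_sym wC) _.
  by split=> // u j _ _ Ruj; apply: CR; exists j.
apply: contrapT => no; apply: empty.
have /nested_prefix_closed : forall s, prefix_closed (stage_class f d R s).
  by move=> s; apply: prefix_closed_finite; apply: stage_class_agree.
case=> [s C [dC Cf CR]|s|C HC].
- split=> // [j js fjs|u j us js]; first by apply: Cf; apply: ltnW.
  by apply: CR; apply: ltnW.
- apply: contrapT => empty; apply: no; exists s.
  apply/allP => w _; apply/negP => /stage_testP Hw; apply: empty.
  by exists (canonical_set w).
exists C; split=> [|j|u [j Ruj]].
- by have [] := HC 0.
(* A stage beyond both [j] and [f j] satisfies the guards on this requirement; the next case does
   the same with [u] and [j]. *)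
- have [_ /(_ j) Cf _] := HC (maxn j (f j)).+1.
  by apply: Cf; rewrite ltnS ?leq_maxl ?leq_maxr.
- have [_ _ /(_ u j) CR] := HC (maxn u j).+1.
  by apply: CR => //; rewrite ltnS ?leq_maxl ?leq_maxr.
Qed.

(** * Computing [A] from [f] at a deciding condition *)

Ltac prove_recursive :=
  repeat first
    [ apply: recursive_var0 | apply: recursive_var1 | apply: recursive_var2
    | apply: recursive_var3 | apply: recursive_var4 | apply: recursive_cst
    | apply: recursiveb_canonical_subset
    | apply: recursiveb_all | apply: recursiveb_has
    | apply: recursiveb_and | apply: recursiveb_or | apply: recursiveb_imply
    | apply: recursiveb_not | apply: recursiveb_leq
    | apply: recursiveb_odd
    | apply: recursive_cpair | apply: recursive_div_exp2 | apply: recursive_exp2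
    | apply: recursive_add | apply: recursive_succ
    | apply: (recursive_oracle tt) ].

Lemma recursiveb_stage_test f d (R RW : nat -> nat -> bool) :
  recursiveb (fun _ : unit => f)
    (fun v : 2.-tuple nat => R (thead v) (thead (behead_tuple v))) ->
  recursiveb (fun _ : unit => f)
    (fun v : 2.-tuple nat => RW (thead v) (thead (behead_tuple v))) ->
  recursiveb (fun _ : unit => f) (fun v : 2.-tuple nat =>
    all (fun w => ~~ stage_test f d
        (fun u j => R u j || RW (cpair u (thead (behead_tuple v))) j)
        (thead v) w)
      (iota 0 (2 ^ (thead v + d)))).
Proof.
move=> rR rW; rewrite /stage_test; prove_recursive.
- by apply: recursiveb_app2 rR _ _; prove_recursive.
- by apply: recursiveb_app2 rW _ _; prove_recursive.
Qed.

Lemma computes_of_forcing A f d E W :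
  sigma1 f E -> sigma1 f W -> sigma1 f (~` A) ->
  forcing_class f d E !=set0 ->
  (forall C, forcing_class f d E C -> enum_apply W C = A) -> computes f A.
Proof.
move=> [R rR ->] [RW rW ->] [RA rA cA] [C0 QC0] QA.
pose T m s := all (fun w => ~~ stage_test f d
  (fun u j => R u j || RW (cpair u m) j) s w) (iota 0 (2 ^ (s + d))).
(* If [m] is in [A], every [C] in the class has [m] in [W(C)], so forbidding the axioms for [m]
   leaves nothing. If not, [C0] survives, since [W(C0) = A] omits [m]. *)
have AT m : A m <-> exists s, T m s.
  rewrite /T -forcing_class_empty; split=> [Am [C [dC Cf CR]]|empty].
    have QC : forcing_class f d [set u | exists s, R u s] C.
      by split=> // u [j Ruj]; apply: CR; exists j; rewrite Ruj.
    move: Am; rewrite -(QA C QC) => -[u [uC [j Wj]]].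
    by apply: (CR u) => //; exists j; rewrite Wj orbT.
  apply: contrapT => nAm; apply: empty; exists C0.
  case: (QC0) => dC Cf CR; split=> // u [j /orP[Ruj|Wj] uC].
    by apply: (CR u) => //; exists j.
  by apply: nAm; rewrite -(QA C0 QC0); exists u; split=> //; exists j.
have nAR m : ~ A m <-> exists s, RA m s by rewrite -[X in X <-> _]/((~` A) m) cA.
have rT : recursiveb (fun _ : unit => f)
    (fun v : 2.-tuple nat => T (thead (behead_tuple v)) (thead v)).
  exact: recursiveb_stage_test.
have rF : recursiveb (fun _ : unit => f) (fun v : 2.-tuple nat =>
    ~~ (T (thead (behead_tuple v)) (thead v) ||
        RA (thead (behead_tuple v)) (thead v))).
  apply/recursiveb_not/recursiveb_or => //.
  exact: recursiveb_app2 rA (recursive_var1 _ _) (recursive_var0 _ _).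
(* Search for the first stage at which [m] is confirmed in [A] or in its complement; [T] at that
   stage is then the answer. *)
have [|S rS HS] := recursive_mu rF.
  move=> v; have [/AT[s Ts]|/nAR[s Rs]] := pselect (A (thead v)); exists s.
    by rewrite behead_cons thead_cons Ts.
  by rewrite behead_cons thead_cons Rs orbT.
have [c Hc] := recursive_subst rT rS.
exists c => m; have := Hc [tuple m]; have := HS [tuple m].
rewrite !(behead_cons, thead_cons); case: orP => // stop _.
congr reval; congr nat_of_bool.
apply/idP/asboolP => [Ts|Am]; first by apply/AT; exists (S [tuple m]).
by case: stop => // Rs; case: (iffRL (nAR m)) => //; exists (S [tuple m]).
Qed.

(** * The principal function of an infinite set *)

Lemma principalP (A : set nat) n : infinite_set A ->
  A (principal A n) /\
  count (fun i => `[< A i >]) (iota 0 (principal A n)) = n.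
Proof.
move=> Ainf; apply: (@xgetPex _ 0 [set x | A x /\ _ = n]).
(* The least element [x >= y] of [A] has the same elements of [A] below it as [y]. Existence at
   every rank keeps [xget] off its default 0. *)
have next y : exists2 x, A x & count (fun i => `[< A i >]) (iota 0 x) =
    count (fun i => `[< A i >]) (iota 0 y).
  have ex : exists x, `[< A x >] && (y <= x).
    apply: contrapT => no; apply: Ainf.
    apply: (@sub_finite_set _ _ `I_y) (finite_II y) => x Ax /=.
    by rewrite ltnNge; apply/negP => yx; apply: no; exists x; rewrite asboolT.
  case: (ex_minnP ex) => x /andP[/asboolP Ax yx] xmin; exists x => //.
  rewrite -(subnKC yx) iotaD count_cat [X in _ + X](_ : _ = 0) ?addn0 //.
  apply/eqP; rewrite -leqn0 leqNgt -has_count; apply/negP => /hasP[i].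
  rewrite mem_iota add0n subnKC // => /andP[yi ix] Ai.
  by have := xmin i; rewrite Ai yi leqNgt ix => /(_ isT).
elim: n => [|n [x [Ax Hx]]].
  by have [x Ax Hx] := next 0; exists x.
have [z Az Hz] := next x.+1; exists z; split=> //.
by rewrite Hz -addn1 iotaD count_cat Hx /= asboolT // addn1.
Qed.

Lemma leq_principal (A : set nat) n : infinite_set A -> n <= principal A n.
Proof.
move/(principalP n) => [_ {1}<-].
by rewrite -[leqRHS](size_iota 0) count_size.
Qed.

(** * The forcing construction *)

Lemma forcing_step A f d E W :
  sigma1 f E -> sigma1 f W -> forcing_class f d E !=set0 ->
  (forall C, forcing_class f d E C -> enum_apply W C = A) \/
  exists d' E', [/\ sigma1 f E', forcing_class f d' E' !=set0,
    forcing_class f d' E' `<=` forcing_class f d E &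
    forall C, forcing_class f d' E' C -> A <> enum_apply W C].
Proof.
move=> sE sW Qn0.
have [all|] := pselect (forall C, forcing_class f d E C -> enum_apply W C = A).
  by left.
move=> /existsNP[C /not_implyP[QC neq]]; right; case: (QC) => dC Cf CE.
(* If [W(C)] has an element outside [A], requiring the finite set that produced it preserves the
   error throughout the new class. *)
have [[n [nA [u [uC Wu]]]]|sub] := pselect (exists n, ~ A n /\ enum_apply W C n).
  have [d' Hd'] := canonical_setU d u; exists d', E; split=> //.
  - by exists C; split=> //; rewrite Hd' => i [/dC|/uC].
  - by move=> C' [dC' ? ?]; split=> // i di; apply: dC'; rewrite Hd'; left.
  - move=> C' [dC' _ _] AW; apply: nA; rewrite AW; exists u; split=> // i ui.
    by apply: dC'; rewrite Hd'; right.
(* Otherwise [W(C)] misses some [n] of [A], and forbidding all axioms for [n] preserves the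
   omission. In both cases [C] itself stays in the class. *)
have [n An nW] : exists2 n, A n & ~ enum_apply W C n.
  apply: contrapT => no; apply: neq; apply/seteqP; split=> n Hn.
    by apply: contrapT => nA; apply: sub; exists n.
  by apply: contrapT => nW; apply: no; exists n.
exists d, (E `|` [set u | W (cpair u n)]); split.
- exact: sigma1_setU_cpair.
- exists C; split=> // u [Eu|Wu] uC; first exact: (CE u).
  by apply: nW; exists u.
- by move=> C' [? ? CE']; split=> // u Eu; apply: CE'; left.
- move=> C' [_ _ CE'] AW; move: An; rewrite AW => -[u [uC' Wu]].
  by apply: (CE' u) => //; right.
Qed.

Theorem theorem4p2 (A : set nat) (hA : introenumerable A) (hc : ce (~` A)) :
  majorreducible A.
Proof.
move=> f fA; case: hA => Ainf Aenum.
apply: contrapT => nfA; have [W HW] := ce_enumeration.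
pose condition := (nat * set nat)%type.
pose class (p : condition) := forcing_class f p.1 p.2.
pose valid (p : condition) := sigma1 f p.2 /\ class p !=set0.
have step (q : nat * condition) : exists p', valid q.2 ->
    [/\ valid p', class p' `<=` class q.2 &
      forall C, class p' C -> ce (W q.1) -> A <> enum_apply (W q.1) C].
  case: q => e [d E] /=.
  (* Invalid conditions get a dummy value. When [W e] is not c.e. there is nothing to defeat and the
     condition is kept. *)
  have [[sE Qn0]|] := pselect (valid (d, E)); last by exists (0, set0).
  have [cW|ncW] := pselect (ce (W e)); last first.
    by exists (d, E) => _; split.
  have sW := ce_sigma1 f cW.
  have [all|[d' [E' [sE' Qn0' sub neq]]]] := forcing_step A sE sW Qn0.
    (* A condition forcing [W e] to give [A] would make [f] compute [A], so only the diagonalizing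
       extension remains. *)
    case: nfA; exact: computes_of_forcing sE sW (ce_sigma1 f hc) Qn0 all.
  by exists (d', E') => _; split=> // C QC _; apply: neq.
have {step}[next Hnext] := choice step.
(* Index 0 requires nothing, and every singleton outside [A] is forbidden, so all members are
   subsets of [A]. *)
pose p0 : condition := (0, [set u | exists2 x, (~` A) x & u = 2 ^ x]).
have valid0 : valid p0.
  split; first exact: ce_sigma1_exp2.
  (* [A] itself meets the interval from [j] to [f j], at [principal A j]. *)
  exists A; split=> [i /canonical_set_lt//|j|u [x nAx ->]].
    exists (principal A j); last by have [] := principalP j Ainf.
    by rewrite leq_principal //=.
  by rewrite canonical_set_exp2 => /(_ x erefl).
pose p := nat_rect (fun=> condition) p0 (fun e q => next (e, q)).
have validp e : valid (p e).
  by elim: e => [|e /(Hnext (e, p e))[]].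
have [||e|C HC] := @nested_prefix_closed (class \o p).
- by move=> e; apply: prefix_closed_forcing_class.
- by move=> e; have [] := Hnext (e, p e) (validp e).
- by have [] := validp e.
have [_ Cf CE] := HC 0.
have CA : C `<=` A.
  move=> x Cx; apply: contrapT => nAx; apply: (CE (2 ^ x)); first by exists x.
  by rewrite canonical_set_exp2 => _ ->.
have Cinf : infinite_set C.
  (* The interval starting just above a supposed maximum contains a larger element of [C]. *)
  move=> /finite_seqP[s Cs]; have [x /andP[lt _]] := Cf (\max_(i <- s) i).+1.
  rewrite Cs /= => xs; suff : x <= \max_(i <- s) i by rewrite leqNgt lt.
  exact: (@leq_bigmax_seq _ s predT id x).
have [V [cV AV]] := Aenum C Cinf CA; have [e eV] := HW V cV.
(* The operator [W e] was defeated in passing from [p e] to [p e.+1], and [C] lies in the latter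
   class. *)
have [_ _ /(_ C (HC e.+1))] := Hnext (e, p e) (validp e).
by rewrite -eV; apply.
Qed.
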